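(* Let $\varGamma$ be a metric graph, and let $R$ be the subsemifield of $\operatorname{Rat}(\varGamma)$ generated over $\boldsymbol{T}$ by the rational functions $f_e, g_e, h_e$ for all $e \in E(G_{\circ})$ and $\operatorname{CF}(\{v\}, \infty)$ for all $v \in V(G_{\circ})$, where $(G_{\circ}, l_{\circ})$ is the canonical model for $\varGamma$. Then $\operatorname{Rat}(\varGamma)$ coincides with $R$. In particular, $\operatorname{Rat}(\varGamma)$ is finitely generated as a semifield over $\boldsymbol{T}$.
   Context: Graphs are unweighted, undirected, finite, connected, nonempty multigraphs that may have loops. A metric graph $\varGamma$ is the underlying topological space of a graph $G$ with a length function $l : E(G) \to \boldsymbol{R}_{>0}$ (all lengths finite), each edge $e$ being identified with the interval $[0,l(e)]$; $(G,l)$ is called a model for $\varGamma$. It carries the path metric $\operatorname{dist}$. The valence $\operatorname{val}(x)$ of a point $x$ is the number of connected components of $U\setminus\{x\}$ for any sufficiently small connected neighborhood $U$ of $x$. The canonical model $(G_{\circ}, l_{\circ})$ for $\varGamma$ is the model with $V(G_{\circ}) = \{x \in \varGamma \mid \operatorname{val}(x) \neq 2\}$, except that when $\varGamma$ is homeomorphic to a circle, $V(G_{\circ})$ consists of one arbitrary point of $\varGamma$. A rational function on $\varGamma$ is either the constant function $-\infty$ or a continuous piecewise affine function $\varGamma \to \boldsymbol{R}$ with integer slopes and finitely many pieces. $\operatorname{Rat}(\varGamma)$ is the set of all rational functions on $\varGamma$, with $\oplus$ the pointwise maximum and $\odot$ the pointwise addition. It is a semifield (a commutative semiring with $0\ne1$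 in which every nonzero element is multiplicatively invertible) with zero element $-\infty$ and unit the constant function $0$. The tropical semifield $\boldsymbol{T} = (\boldsymbol{R}\cup\{-\infty\}, \max, +)$ is included in it as the constant functions. The semifield generated over $\boldsymbol{T}$ by a subset of $\operatorname{Rat}(\varGamma)$ is the smallest subsemifield of $\operatorname{Rat}(\varGamma)$ containing $\boldsymbol{T}$ and the subset; finitely generated as a semifield over $\boldsymbol{T}$ means generated over $\boldsymbol{T}$ in this sense by a finite subset. A subgraph of $\varGamma$ is a compact nonempty subset with finitely many connected components. For a subgraph $\varGamma_1$ and $l \in \boldsymbol{R}_{>0}\cup\{\infty\}$, the chip firing move is the rational function $\operatorname{CF}(\varGamma_1,l)(x) := -\min\{\operatorname{dist}(\varGamma_1,x), l\}$. Fix a direction on each edge of $G_{\circ}$ and identify each $e \in E(G_{\circ})$ with $[0,l_{\circ}(e)]$ accordingly. Let $x_e, y_e, z_e$ be the points of $e$ with coordinates $\frac{l_{\circ}(e)}{4}, \frac{l_{\circ}(e)}{2}, \frac{3l_{\circ}(e)}{4}$, and put $f_e := \operatorname{CF}(\{y_e\}, \frac{l_{\circ}(e)}{2})$, $g_e := \operatorname{CF}(\{x_e\}, \frac{l_{\circ}(e)}{4})$, $h_e := \operatorname{CF}(\{z_e\}, \frac{l_{\circ}(e)}{4})$. *)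

(* Defs.v *)
From HB Require Import structures.
From mathcomp Require Import all_boot all_order all_algebra.
From mathcomp Require Import all_classical all_reals all_analysis.

Set Implicit Arguments.
Unset Strict Implicit.
Unset Printing Implicit Defensive.

Import Order.TTheory GRing.Theory Num.Theory.
Import numFieldNormedType.Exports.

Local Open Scope classical_set_scope.
Local Open Scope ring_scope.

(* Finite multigraphs; loops and parallel edges are allowed.  The graph is
   undirected: [src] and [tgt] record a chosen direction on each edge, which is
   only used to identify the edge with a real interval. *)
Record multigraph := Multigraph {
  vertex : finType;
  edge : finType;
  src : edge -> vertex;
  tgt : edge -> vertex }.

Definition adjacent (G : multigraph) : rel (vertex G) := fun u v =>
  [exists e : edge G, (src e == u) && (tgt e == v)
                   || (src e == v) && (tgt e == u)].

Definition nonempty_graph (G : multigraph) : Prop := (0 < #|vertex G|)%N.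

Definition connected_graph (G : multigraph) : Prop :=
  forall u v : vertex G, connect (@adjacent G) u v.

Section Paths.
Variables (R : realType) (X : Type) (G : multigraph).
Variables (len : edge G -> R) (pt : edge G -> R -> X).

(* A piecewise linear path from [x] to [y]: the step [(e, s, t)] runs inside
   the edge [e] from the point of coordinate [s] to the one of coordinate [t]. *)
Fixpoint is_path (x : X) (p : seq (edge G * R * R)) (y : X) : Prop :=
  match p with
  | [::] => x = y
  | (e, s, t) :: q =>
      [/\ 0 <= s <= len e, 0 <= t <= len e, x = pt e s & is_path (pt e t) q y]
  end.

Definition path_length (p : seq (edge G * R * R)) : R :=
  \sum_(c <- p) `|c.2 - c.1.2|.

Definition path_dist (x y : X) : R :=
  inf [set path_length p | p in [set p | is_path x p y]].

End Paths.

(* A model [(G, l)] for [X]: the edge [e] is identified with [0, l(e)] through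
   [ept e] (whose values outside that interval are irrelevant); the conditions
   say that [X] is, as a set, the quotient of the disjoint union of the vertices
   and of the intervals [0, l(e)] by the gluing of the endpoints, and that its
   metric (hence its topology) is the path metric. *)
Record model (R : realType) (X : metricType R) := Model {
  graph :> multigraph;
  graph_nonempty : nonempty_graph graph;
  graph_connected : connected_graph graph;
  len : edge graph -> R;
  len_gt0 : forall e, 0 < len e;
  vpt : vertex graph -> X;
  ept : edge graph -> R -> X;
  ept_src : forall e, ept e 0 = vpt (src e);
  ept_tgt : forall e, ept e (len e) = vpt (tgt e);
  model_surj : forall x : X,
    (exists v, x = vpt v) \/ (exists e (t : R), 0 < t < len e /\ x = ept e t);
  vpt_inj : injective vpt;
  ept_inj : forall e e' (t t' : R), 0 < t < len e -> 0 < t' < len e' ->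
    ept e t = ept e' t' -> e = e' /\ t = t';
  ept_vpt : forall e (t : R) v, 0 < t < len e -> ept e t <> vpt v;
  model_dist : forall x y, mdist x y = path_dist len ept x y }.

Definition metric_graph (R : realType) (X : metricType R) : Prop :=
  inhabited (model X).

(* [val x = n] *)
Definition has_valence (X : topologicalType) (x : X) (n : nat) : Prop :=
  exists2 W, nbhs x W & forall U, nbhs x U -> connected U -> U `<=` W ->
    ([set connected_component (U `\ x) y | y in U `\ x] #= `I_n)%card.

Definition unit_circle (R : realType) : set (R * R) :=
  [set p | p.1 ^+ 2 + p.2 ^+ 2 = 1].
Arguments unit_circle : clear implicits.

Definition homeomorphic_to_circle (R : realType) (X : topologicalType) : Prop :=
  exists (f : X -> R * R) (g : R * R -> X),
    [/\ continuous f, {within unit_circle R, continuous g},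
        range f = unit_circle R & cancel f g].

Definition canonical_model (R : realType) (X : metricType R) (M : model X) :
    Prop :=
  (~ homeomorphic_to_circle R X ->
     range (@vpt R X M) = [set x | ~ has_valence x 2]) /\
  (homeomorphic_to_circle R X -> exists x, range (@vpt R X M) = [set x]).

(* Affine with integer slope on each piece of a finite subdivision of
   [a, b] (with a < b). *)
Definition piecewise_affine (R : realType) (a b : R) (g : R -> R) : Prop :=
  exists2 s, itv_partition a b s & forall i, (i < size s)%N ->
    exists (m : int) (c : R), forall t,
      nth a (a :: s) i <= t <= nth a (a :: s) i.+1 -> g t = m%:~R * t + c.

Section RationalFunctions.
Variables (R : realType) (X : metricType R).

(* Being piecewise affine with integer slopes does not depend on the model,
   since any two models have a common subdivision. *)
Definition RatFun : set (X -> \bar R) := [set F | F = cst -oo%E \/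
  exists f : X -> R, [/\ F = EFin \o f, continuous f &
    forall (M : model X) (e : edge M),
      piecewise_affine 0 (len e) (fun t => f (ept e t))]].

Definition trop_add (F H : X -> \bar R) : X -> \bar R :=
  fun x => maxe (F x) (H x).

Definition trop_mul (F H : X -> \bar R) : X -> \bar R :=
  fun x => (F x + H x)%E.

Record subsemifield (S : set (X -> \bar R)) : Prop := Subsemifield {
  subsemifield_RatFun : S `<=` RatFun;
  subsemifield0 : S (cst -oo%E);
  subsemifield1 : S (cst 0%E);
  subsemifieldD : forall F H, S F -> S H -> S (trop_add F H);
  subsemifieldM : forall F H, S F -> S H -> S (trop_mul F H);
  subsemifieldV : forall F, S F -> F <> cst -oo%E ->
    exists2 H, S H & trop_mul F H = cst 0%E }.

(* The tropical semifield T, as the constant functions. *)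
Definition trop_constants : set (X -> \bar R) :=
  [set cst c | c in [set c : \bar R | c <> +oo%E]].

Definition generated_semifield (A : set (X -> \bar R)) : set (X -> \bar R) :=
  smallest subsemifield (trop_constants `|` A).

Definition finitely_generated_semifield (S : set (X -> \bar R)) : Prop :=
  exists A : set (X -> \bar R),
    [/\ finite_set A, A `<=` RatFun & S = generated_semifield A].

Definition set_dist (A : set X) (x : X) : \bar R :=
  ereal_inf [set (mdist a x)%:E | a in A].

Definition CF (A : set X) (l : \bar R) : X -> \bar R :=
  fun x => (- mine (set_dist A x) l)%E.

Variable M : model X.

Definition f_ (e : edge M) : X -> \bar R :=
  CF [set ept e (len e / 2)] (len e / 2)%:E.

Definition g_ (e : edge M) : X -> \bar R :=
  CF [set ept e (len e / 4)] (len e / 4)%:E.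

Definition h_ (e : edge M) : X -> \bar R :=
  CF [set ept e (3 * len e / 4)] (len e / 4)%:E.

Definition model_generators : set (X -> \bar R) :=
  range f_ `|` range g_ `|` range h_ `|`
  range (fun v : vertex M => CF [set vpt v] +oo%E).

End RationalFunctions.

Arguments RatFun {R} X _.

(* Main.v *)
Require Import Defs.
From mathcomp Require Import all_boot all_order all_algebra.
From mathcomp Require Import all_classical all_reals all_analysis.
From mathcomp Require Import ring lra.

(** Let S be a semifield of rational functions that contains the constants and
    the generators.  A rational function F is recovered as a maximum of finitely
    many functions of S, one for each piece of F.  Fix a model M; then F is
    affine on each of finitely many segments, which may be taken inside
    half-edges, and these segments together with the vertices cover the space.
    For such a segment I it suffices to find phi in S with phi = F on I and
    phi <= F everywhere ([covers]); the maximum of all these phi is then F.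

    The function phi is A - n psi, where A in S agrees with F on I, psi >= 0 in
    S vanishes on I and grows at a definite rate away from I, in the sense that
    dist(x, I) <= 4 psi(x), and n is a large integer.  Both A and F are
    Lipschitz for the path metric, so that A - F <= const * dist(., I) is
    dominated by n psi ([covers_peak]).

    It remains to find A and psi.  Up to a constant, f_e, g_e and h_e are the
    tents T, G, H that vanish off the edge e and are supported on the whole of
    e, on its first half and on its second half ([CF_bump], [bump_on],
    [bump_off]).  On the first half of e the tent T is the coordinate, hence
    A = m T + c.  For I = [a, b] in the first half, with D the distance to the
    source of e, take

        psi = max(a - T, D - T, T - b, H).

    On the edge, a - T and T - b are both nonpositive exactly on I and on its
    mirror image in the other half, which H excludes except for an end that it
    shares with I or, if a = 0, the far end of e.  The latter, and the points
    off the edge when a = 0, have T = 0 and are excluded by D - T = D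
    ([tent_penalty_ge]).  The second half is obtained by reversing e, with G
    in place of H, and at a vertex v one takes A constant and psi = dist(v, .).

    Conversely the generators are rational because the distance to a point is
    piecewise affine with slopes 1 and -1 along the edges of every model
    ([mdist_edge]).  The path metric is an infimum over paths, so upper bounds
    on it come from exhibiting a path; lower bounds come from test functions
    that are 1-Lipschitz along the edges, which are 1-Lipschitz for the path
    metric ([edge_lipschitz_mdist]). *)

Set Implicit Arguments.
Unset Strict Implicit.
Unset Printing Implicit Defensive.

Import Order.TTheory GRing.Theory Num.Theory.
Import numFieldNormedType.Exports.

Local Open Scope classical_set_scope.
Local Open Scope ring_scope.

(** * Piecewise affine functions on an interval *)

Section Pwa.
Variable R : realType.
Implicit Types (a b c t : R) (f g : R -> R).

(** Piecewise affine functions as the closure of the affine ones under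
    concatenation of intervals; unlike an explicit subdivision, this makes the
    closure properties below straightforward inductions. *)
Inductive pwa g : R -> R -> Prop :=
| pwa_affine a b (m : int) c : a < b ->
    (forall t, a <= t <= b -> g t = m%:~R * t + c) -> pwa g a b
| pwa_cat a b c : pwa g a b -> pwa g b c -> pwa g a c.

Lemma pwa_lt g a b : pwa g a b -> a < b.
Proof. by elim=> // {}a {}b c _ ab _; exact: lt_trans. Qed.

Lemma piecewise_affine_pwa a b g :
  a < b -> piecewise_affine a b g -> pwa g a b.
Proof.
move=> ab [s]; elim: s a ab => [|x s IH] a ab.
  by move=> /itv_partition_nil ab0; move: ab; rewrite ab0 ltxx.
move=> [/= /andP[ax xs] lastb] aff.
have [m [c /= gax]] := aff 0%N isT.
have gx : pwa g a x by exact: pwa_affine ax gax.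
case: s => [|y s] in IH xs lastb aff *; first by rewrite -(eqP lastb).
have xb : x < b.
  rewrite -(eqP lastb); have /allP := order_path_min lt_trans xs.
  by apply; rewrite /= mem_last.
apply: (pwa_cat gx); apply: IH => // i ilt.
have [m' [c' H]] := aff i.+1 ilt.
exists m', c' => t; rewrite !(set_nth_default a x) /= ?ltnS ?(ltnW ilt) //.
exact: H.
Qed.

Lemma pwa_piecewise_affine a b g : pwa g a b -> piecewise_affine a b g.
Proof.
elim=> {a b} [a b m c ab gab|a b c _ [s [ps /eqP ls] affs] _ [u [pu lu] affu]].
  exists [:: b]; first exact: itv_partition1.
  by case=> // _; exists m, c.
exists (s ++ u).
  by apply: itv_partition_cat; first split; rewrite ?ls.
have nl j : (j <= size s)%N -> nth a (a :: s ++ u) j = nth a (a :: s) j.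
  by rewrite -ltnS -cat_cons nth_cat => /= ->.
have nr j : (j <= size u)%N ->
    nth a (a :: s ++ u) (size s + j) = nth b (b :: u) j.
  case: j => [|j] ju; first by rewrite addn0 nl //= -(last_nth a) ls.
  by rewrite addnS /= nth_cat ltnNge leq_addr addKn; exact: set_nth_default.
move=> i; rewrite size_cat => iu.
have [si|si] := ltnP i (size s).
  have [m [d H]] := affs i si; exists m, d => t.
  by rewrite !nl ?(ltnW si) //; exact: H.
rewrite -(subnKC si) ltn_add2l in iu *.
have [m [d H]] := affu _ iu; exists m, d => t.
by rewrite -addnS !nr // ?(ltnW iu) //; exact: H.
Qed.

Lemma pwa_ext f g a b :
  (forall t, a <= t <= b -> f t = g t) -> pwa f a b -> pwa g a b.
Proof.
move=> + H; elim: H => {a b} [a b m c ab H|a b c pab + pbc +] fg.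
  by apply: (@pwa_affine _ a b m c) => // t tab; rewrite -fg // H.
have [ab bc] := (pwa_lt pab, pwa_lt pbc).
move=> H1 H2; apply: pwa_cat (H1 _) (H2 _) => t tab; apply: fg; lra.
Qed.

Lemma pwa_restrict g a b a' b' :
  a <= a' -> a' < b' -> b' <= b -> pwa g a b -> pwa g a' b'.
Proof.
move=> aa' ab' bb' H; elim: H a' b' aa' ab' bb' => {a b}
  [a b m c ab H|a b c pab IH1 pbc IH2] a' b' aa' ab' bb'.
  apply: (@pwa_affine _ _ _ m c) => // t tab; apply: H; lra.
have [b'b|bb''] := leP b' b; first by apply: IH1.
have [ba'|a'b] := leP b a'; first by apply: IH2.
by apply: (@pwa_cat _ _ b); [apply: IH1|apply: IH2] => //; exact: ltW.
Qed.

Lemma pwa_linear (m : int) c a b : a < b -> pwa (fun t => m%:~R * t + c) a b.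
Proof. by move=> ab; apply: pwa_affine ab _ => t _. Qed.

(** A binary operation that preserves piecewise affinity on pairs of affine
    functions preserves it always: restrict either function to the pieces of the
    other, which replaces the choice of a common subdivision. *)
Lemma pwa_op (op : R -> R -> R) :
  (forall a b (m m' : int) c c', a < b ->
     pwa (fun t => op (m%:~R * t + c) (m'%:~R * t + c')) a b) ->
  forall f g a b, pwa f a b -> pwa g a b -> pwa (fun t => op (f t) (g t)) a b.
Proof.
move=> opA f g a b H; elim: H => {a b} [a b m c ab fE|a b c pab IH1 pbc IH2] pg.
  elim: pg fE {ab} => {a b} [a b m' c' ab gE|a b d pab IH1 pbc IH2] fE.
    apply: pwa_ext (opA a b m m' c c' ab) => t tab.
    by rewrite fE // gE.
  have [ab bd] := (pwa_lt pab, pwa_lt pbc).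
  by apply: pwa_cat (IH1 _) (IH2 _) => t tab; apply: fE; lra.
have [ab bc] := (pwa_lt pab, pwa_lt pbc).
apply: pwa_cat (IH1 _) (IH2 _).
  by apply: pwa_restrict pg => //; exact: ltW.
by apply: pwa_restrict pg => //; exact: ltW.
Qed.

Lemma pwaD f g a b : pwa f a b -> pwa g a b -> pwa (fun t => f t + g t) a b.
Proof.
apply: (@pwa_op (fun x y => x + y)) => {}a {}b m m' c c' ab.
by apply: (@pwa_affine _ _ _ (m + m') (c + c')) => // t _; rewrite intrD; ring.
Qed.

Lemma pwaN f a b : pwa f a b -> pwa (fun t => - f t) a b.
Proof.
move=> H; have := H.
apply: (@pwa_op (fun x y => - x)) H => {}a {}b m m' c c' ab.
by apply: (@pwa_affine _ _ _ (- m) (- c)) => // t _; rewrite intrN; ring.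
Qed.

Lemma pwa_max_ordered a b (m m' : int) c c' : a < b ->
  m'%:~R * a + c' <= m%:~R * a + c -> m'%:~R * b + c' <= m%:~R * b + c ->
  pwa (fun t => Num.max (m%:~R * t + c) (m'%:~R * t + c')) a b.
Proof.
move=> ab ha hb; apply: (@pwa_affine _ _ _ m c) => // t /andP[at_ tb].
apply/max_idPl; nra.
Qed.

Lemma pwa_max f g a b :
  pwa f a b -> pwa g a b -> pwa (fun t => Num.max (f t) (g t)) a b.
Proof.
apply: (@pwa_op Num.max) => {}a {}b m m' c c' ab.
wlog ma : m m' c c' / m'%:~R * a + c' <= m%:~R * a + c.
  move=> H; have [|/ltW] := leP (m'%:~R * a + c') (m%:~R * a + c).
    exact: H.
  by move/H; apply: pwa_ext => t _; rewrite maxC.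
have [|mb] := leP (m'%:~R * b + c') (m%:~R * b + c).
  exact: pwa_max_ordered.
have [ma'|ma'] := leP (m%:~R * a + c) (m'%:~R * a + c').
  apply: (@pwa_ext (fun t => Num.max (m'%:~R * t + c') (m%:~R * t + c))).
    by move=> t _; rewrite maxC.
  by apply: pwa_max_ordered => //; exact: ltW.
(* The two lines cross inside the interval; cut at the crossing point r. *)
pose k : R := m'%:~R - m%:~R.
have k0 : 0 < k by rewrite /k; nra.
pose r := (c - c') / k.
have rE : k * r = c - c' by rewrite /r; field; rewrite gt_eqF.
have rE' : m'%:~R * r + c' = m%:~R * r + c by move: rE; rewrite /k; lra.
have ar : a < r by rewrite /r ltr_pdivlMr // /k; lra.
have rb : r < b by rewrite /r ltr_pdivrMr // /k; lra.
apply: (@pwa_cat _ _ r); first by apply: pwa_max_ordered => //; rewrite rE'.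
apply: (@pwa_ext (fun t => Num.max (m'%:~R * t + c') (m%:~R * t + c))).
  by move=> t _; rewrite maxC.
by apply: pwa_max_ordered => //; rewrite ?rE' // ltW.
Qed.

Lemma pwa_min f g a b :
  pwa f a b -> pwa g a b -> pwa (fun t => Num.min (f t) (g t)) a b.
Proof.
move=> /pwaN pf /pwaN pg; apply: pwa_ext (pwaN (pwa_max pf pg)) => t _.
by rewrite oppr_max !opprK.
Qed.

Lemma pwa_lipschitz g a b : pwa g a b -> exists2 K, 0 < K &
  forall t t', a <= t <= b -> a <= t' <= b -> `|g t - g t'| <= K * `|t - t'|.
Proof.
elim=> {a b} [a b m c ab gE|a b c pab [K K0 H] pbc [K' K'0 H']].
  exists (`|m%:~R| + 1); first by rewrite ltr_wpDl.
  move=> t t' tab t'ab; rewrite !gE //.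
  rewrite (_ : _ - _ = m%:~R * (t - t')); last by ring.
  by rewrite normrM ler_wpM2r // lerDl.
exists (K + K') => [|t t']; first exact: addr_gt0.
have [ab bc] := (pwa_lt pab, pwa_lt pbc).
wlog tt' : t t' / t <= t'.
  move=> W; have [|/ltW] := leP t t'; first exact: W.
  by rewrite distrC (distrC t) => /W + *; apply.
move=> tac t'ac.
have n0 := normr_ge0 (t - t').
have [t'b|bt'] := leP t' b.
  by apply: le_trans (H _ _ _ _) _; [lra|lra|nra].
have [bt|tb] := leP b t.
  by apply: le_trans (H' _ _ _ _) _; [lra|lra|nra].
have h1 : `|g t - g b| <= K * `|t - b| by apply: H; lra.
have h2 : `|g b - g t'| <= K' * `|b - t'| by apply: H'; lra.
have := ler_distD (g b) (g t) (g t').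
have -> : `|t - t'| = t' - t by rewrite ler0_norm; lra.
move: h1 h2; rewrite (@ler0_norm _ (t - b)) ?(@ler0_norm _ (b - t')); try lra.
by move=> h1 h2 h3; nra.
Qed.

End Pwa.

(** * Distances along an edge of a model *)

Section EdgeGeometry.
Variables (R : realType) (X : metricType R) (M : model X).
Implicit Types (e : edge M) (v : vertex M) (t s r : R) (x y : X) (u : X -> R).

Definition on_edge e : set R := [set t | 0 <= t <= len e].

Definition edge_lipschitz (K : R) u := forall e t t',
  on_edge e t -> on_edge e t' -> `|u (ept e t) - u (ept e t')| <= K * `|t - t'|.

Lemma path_length_ge0 (p : seq (edge M * R * R)) : 0 <= path_length p.
Proof. by apply: sumr_ge0 => i _. Qed.

Lemma mdist_le_path x y p : is_path (@len _ _ M) (@ept _ _ M) x p y ->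
  mdist x y <= path_length p.
Proof.
move=> xpy; rewrite (model_dist M); apply: ge_inf; last by exists p.
by exists 0 => _ [q _ <-]; exact: path_length_ge0.
Qed.

(** Summing the increments of u along a path bounds |u x - u y| by K times its
    length.  Points at positive distance are joined by a path, since the infimum
    of the empty set is 0. *)
Lemma edge_lipschitz_mdist K u : 0 < K -> edge_lipschitz K u ->
  forall x y, `|u x - u y| <= K * mdist x y.
Proof.
move=> K0 uK x y.
have [->|/eqP xy] := pselect (x = y).
  by rewrite subrr normr0 mdistxx mulr0.
have upath p : is_path (@len _ _ M) (@ept _ _ M) x p y ->
    `|u x - u y| / K <= path_length p.
  rewrite ler_pdivrMr // mulrC /path_length.
  elim: p {xy} x => [x /= ->|[[e s] t] p IH x /= [se te -> py]].
    by rewrite subrr normr0 big_nil mulr0.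
  rewrite big_cons mulrDr (le_trans (ler_distD (u (ept e t)) _ _)) //.
  by apply: lerD; [rewrite (distrC t); exact: uK|exact: IH].
rewrite mulrC -ler_pdivrMr // (model_dist M); apply: lb_le_inf.
  apply/set0P/negP => /eqP E; move: xy.
  by rewrite -mdist_gt0 (model_dist M) /path_dist E inf0 ltxx.
by move=> _ [p xpy <-]; exact: upath.
Qed.

Lemma mdist_edge_le e t t' : on_edge e t -> on_edge e t' ->
  mdist (ept e t) (ept e t') <= `|t - t'|.
Proof.
move=> te te'; rewrite distrC.
have := @mdist_le_path (ept e t) (ept e t') [:: (e, t, t')].
by rewrite /path_length big_seq1; apply.
Qed.

Lemma edge_lipschitz_mdistl x : edge_lipschitz 1 (mdist x).
Proof.
move=> e t t' te te'; rewrite mul1r; apply: le_trans (mdist_edge_le te te').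
rewrite ler_distl; have h1 := metric_triangle x (ept e t) (ept e t').
have := metric_triangle x (ept e t') (ept e t).
by rewrite (metric_sym (ept e t')); lra.
Qed.

Definition edge_interior e : set X :=
  [set x | exists t, 0 < t < len e /\ x = ept e t].

(** The test functions: u0 modified inside one edge, where it is given by the
    function w of the coordinate. *)
Definition glue e (w : R -> R) (u0 : X -> R) (x : X) : R :=
  if pselect (edge_interior e x) is left _
  then w (xget 0 [set t | 0 < t < len e /\ x = ept e t]) else u0 x.

Lemma glue_off e w u0 x : ~ edge_interior e x -> glue e w u0 x = u0 x.
Proof. by rewrite /glue; case: pselect. Qed.

Lemma vertex_off e v : ~ edge_interior e (vpt v).
Proof. by move=> [t [te /esym]]; exact: ept_vpt. Qed.

Lemma on_edge_cases e t : on_edge e t ->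
  [\/ t = 0, t = len e | 0 < t < len e].
Proof.
rewrite /on_edge/= !le_eqVlt.
move=> /andP[/orP[/eqP<-|t0] /orP[/eqP|tl]]; last first.
- by constructor 3; rewrite t0.
- by constructor 2.
- by constructor 1.
- by constructor 1.
Qed.

Lemma other_edge_off e e' t : e' != e -> on_edge e' t ->
  ~ edge_interior e (ept e' t).
Proof.
move=> ee' /on_edge_cases[->|->|te'].
- by rewrite ept_src; exact: vertex_off.
- by rewrite ept_tgt; exact: vertex_off.
- by move=> [t' [te /ept_inj[]// E _]]; move: ee'; rewrite E eqxx.
Qed.

Lemma on_edge0 e : on_edge e 0.
Proof. by rewrite /on_edge /= lexx ltW // len_gt0. Qed.

Lemma on_edge_len e : on_edge e (len e).
Proof. by rewrite /on_edge /= lexx ltW // len_gt0. Qed.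

Lemma glue_on e w u0 t : w 0 = u0 (ept e 0) -> w (len e) = u0 (ept e (len e)) ->
  on_edge e t -> glue e w u0 (ept e t) = w t.
Proof.
move=> w0 wl /on_edge_cases[->|->|te].
- by rewrite glue_off // ept_src; exact: vertex_off.
- by rewrite glue_off // ept_tgt; exact: vertex_off.
- rewrite /glue; case: pselect => [H|[]]; last by exists t.
  by case: xgetP => [t' _ [t'e /ept_inj[]//_ ->]//|/(_ t) []].
Qed.

Lemma glue_lipschitz e w u0 : edge_lipschitz 1 u0 ->
  w 0 = u0 (ept e 0) -> w (len e) = u0 (ept e (len e)) ->
  (forall t t', on_edge e t -> on_edge e t' -> `|w t - w t'| <= `|t - t'|) ->
  edge_lipschitz 1 (glue e w u0).
Proof.
move=> u0L w0 wl wL e' t t'; have [->|ee'] := eqVneq e' e.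
  by move=> te te'; rewrite mul1r !glue_on //; exact: wL.
by move=> te te'; rewrite !glue_off; first exact: u0L; exact: other_edge_off.
Qed.

(** When the segment [s - r, s + r] lies in e, this is the tent of height r over
    that segment: the ball of radius r around the point of coordinate s does not
    leave the edge. *)
Definition bump e s r x : R := Num.max (r - mdist (ept e s) x) 0.

(** Upper bounds on the distance give one inequality; for the other one, the
    right-hand side is itself 1-Lipschitz and equals r at the centre. *)
Lemma bump_glue e s r : 0 <= r -> r <= s -> s + r <= len e ->
  bump e s r = glue e (fun t => Num.max (r - `|t - s|) 0) (cst 0).
Proof.
move=> r0 rs sr; set w := fun t => _.
have w0 : w 0 = cst 0 (ept e 0).
  by apply/max_idPr; rewrite sub0r normrN ger0_norm; lra.
have wl : w (len e) = cst 0 (ept e (len e)).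
  by apply/max_idPr; rewrite ger0_norm; lra.
have wL t t' : on_edge e t -> on_edge e t' -> `|w t - w t'| <= `|t - t'|.
  move=> _ _; have h := ler_distD t t' s; have h' := ler_distD t' t s.
  rewrite (distrC t' t) in h.
  have h0 := normr_ge0 (t - t'); rewrite /w ler_distl.
  by case: (lerP (r - `|t - s|)); case: (lerP (r - `|t' - s|)); lra.
have se : on_edge e s by rewrite /on_edge /=; lra.
have uL := glue_lipschitz (u0 := cst 0) _ w0 wl wL.
have {}uL : edge_lipschitz 1 (glue e w (cst 0)).
  by apply: uL => e' t t' _ _; rewrite subrr normr0 mul1r.
apply/funext => x; apply/eqP; rewrite eq_le /bump.
apply/andP; split; last first.
  rewrite le_max; have [[t [te ->]]|xe] := pselect (edge_interior e x).
    have te' : on_edge e t by rewrite /on_edge /=; lra.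
    rewrite glue_on // /w; have := mdist_edge_le se te'; rewrite distrC.
    case: (lerP (r - `|t - s|)); last by move=> + ?; lra.
    by move=> *; rewrite lexx orbT.
  by rewrite glue_off // lexx orbT.
rewrite ge_max; apply/andP; split.
  have := edge_lipschitz_mdist ltr01 uL (ept e s) x.
  rewrite mul1r ler_distl (glue_on w0 wl se).
  have -> : w s = r by rewrite /w subrr normr0 subr0; exact/max_idPl.
  by lra.
have [[t [te ->]]|xe] := pselect (edge_interior e x); last by rewrite glue_off.
rewrite glue_on //; first by rewrite /w le_max lexx orbT.
by rewrite /on_edge /=; lra.
Qed.

Lemma bump_on e s r t : 0 <= r -> r <= s -> s + r <= len e -> on_edge e t ->
  bump e s r (ept e t) = Num.max (r - `|t - s|) 0.
Proof.
move=> r0 rs sr te; rewrite bump_glue // glue_on //.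
  by apply/max_idPr; rewrite sub0r normrN ger0_norm; lra.
by apply/max_idPr; rewrite ger0_norm; lra.
Qed.

Lemma bump_off e s r x : 0 <= r -> r <= s -> s + r <= len e ->
  ~ edge_interior e x -> bump e s r x = 0.
Proof. by move=> r0 rs sr xe; rewrite bump_glue // glue_off. Qed.

Lemma bump_lipschitz e s r x y : `|bump e s r x - bump e s r y| <= mdist x y.
Proof.
rewrite /bump ler_distl; set z := ept e s.
have := metric_triangle z x y; have := metric_triangle z y x.
rewrite (metric_sym y x); have := mdist_ge0 x y.
by case: (lerP (r - mdist z x) 0); case: (lerP (r - mdist z y) 0); lra.
Qed.

Lemma CF1 x r y : CF [set x] r%:E y = (- Num.min (mdist x y) r)%:E.
Proof. by rewrite /CF /set_dist image_set1 ereal_inf1 -EFin_min. Qed.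

Lemma CF1_pinfty x y : CF [set x] +oo y = (- mdist x y)%:E.
Proof.
rewrite /CF /set_dist image_set1 ereal_inf1 EFinN; congr (- _)%E.
exact/min_idPl/leey.
Qed.

Lemma CF_bump e s r :
  CF [set ept e s] r%:E = EFin \o (fun x => bump e s r x - r).
Proof.
apply/funext => x; rewrite CF1 /bump /=; congr EFin.
case: (lerP (mdist (ept e s) x) r) => h;
  by case: (lerP (r - mdist (ept e s) x) 0) => h'; lra.
Qed.

(** A shortest path from x to a point of e either enters e through one of its
    ends or, when x lies in e, stays in e; so the distance is a minimum of at
    most three explicit functions of the coordinate.  That it is not smaller is
    shown by gluing this minimum into the distance to x. *)
Lemma mdist_edge x e : exists w : R -> R, pwa w 0 (len e) /\
  forall t, on_edge e t -> mdist x (ept e t) = w t.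
Proof.
have l0 := len_gt0 e.
pose d0 := mdist x (ept e 0); pose d1 := mdist x (ept e (len e)).
have linL : pwa (fun t => 1%:~R * t + d0) 0 (len e) by exact: pwa_linear.
have linR : pwa (fun t => (-1)%:~R * t + (d1 + len e)) 0 (len e).
  exact: pwa_linear.
pose w1 t := Num.min (d0 + t) (d1 + len e - t).
have pw1 : pwa w1 0 (len e).
  apply: pwa_ext (pwa_min linL linR) => t _; rewrite /w1.
  by rewrite mulr1z mul1r (addrC t) mulrN1z mulN1r (addrC (- t)).
have w1L t t' : `|w1 t - w1 t'| <= `|t - t'|.
  rewrite /w1 ler_distl; have := ler_norm (t - t'); have := ler_norm (t' - t).
  rewrite (distrC t' t).
  by case: (lerP (d0 + t)); case: (lerP (d0 + t')) => *; lra.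
have xw1 t : on_edge e t -> mdist x (ept e t) <= w1 t.
  move=> te; rewrite /w1 le_min; apply/andP; split.
    have := metric_triangle x (ept e 0) (ept e t).
    have := mdist_edge_le (on_edge0 e) te; rewrite sub0r normrN ger0_norm.
      by rewrite /d0; lra.
    by case/andP: te.
  have := metric_triangle x (ept e (len e)) (ept e t).
  have := mdist_edge_le (on_edge_len e) te; rewrite ger0_norm.
    by rewrite /d1; lra.
  by rewrite subr_ge0; case/andP: te.
have d01 : `|d0 - d1| <= len e.
  have := edge_lipschitz_mdistl x (on_edge0 e) (on_edge_len e).
  by rewrite mul1r sub0r normrN (gtr0_norm l0).
rewrite ler_distl in d01.
have w10 : w1 0 = d0 by rewrite /w1 addr0; apply/min_idPl; lra.
have w1l : w1 (len e) = d1 by rewrite /w1 addrK; apply/min_idPr; lra.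
have lower w : w 0 = d0 -> w (len e) = d1 ->
    (forall t t', on_edge e t -> on_edge e t' -> `|w t - w t'| <= `|t - t'|) ->
    glue e w (mdist x) x = 0 ->
    forall t, on_edge e t -> w t <= mdist x (ept e t).
  move=> w0 wl wL wx t te.
  have uL := glue_lipschitz (@edge_lipschitz_mdistl x) w0 wl wL.
  have := edge_lipschitz_mdist ltr01 uL x (ept e t).
  rewrite wx glue_on // mul1r ler_distl; lra.
have [[s [se xE]]|xe] := pselect (edge_interior e x); last first.
  exists w1; split=> // t te; apply/eqP; rewrite eq_le xw1 //=.
  by apply: lower => //; rewrite glue_off // mdistxx.
have se' : on_edge e s by rewrite /on_edge /=; lra.
exists (fun t => Num.min (w1 t) `|t - s|); split.
  apply: pwa_min => //.
  have p1 : pwa (fun t => 1%:~R * t + - s) 0 (len e) by exact: pwa_linear.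
  apply: pwa_ext (pwa_max p1 (pwaN p1)) => t _.
  by rewrite mulr1z mul1r maxrN.
have xs t : on_edge e t -> mdist x (ept e t) <= `|t - s|.
  by move=> te; rewrite xE distrC; exact: mdist_edge_le.
move=> t te; apply/eqP; rewrite eq_le le_min xw1 //= xs //=.
apply: (lower (fun t => Num.min (w1 t) `|t - s|)) => //.
- by rewrite w10; apply/min_idPl/xs/on_edge0.
- by rewrite w1l; apply/min_idPl/xs/on_edge_len.
- move=> {te}t t' te te'; have := w1L t t'; rewrite ler_distl.
  have := ler_distD t t' s; have := ler_distD t' t s; rewrite (distrC t' t).
  case: (lerP (w1 t) `|t - s|); case: (lerP (w1 t') `|t' - s|) => *;
    by rewrite ler_distl; lra.
- rewrite [X in glue _ _ _ X]xE glue_on ?subrr ?normr0 //.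
  + by apply/min_idPr; rewrite -(mdistxx x) {2}xE; exact: xw1.
  + by rewrite w10; apply/min_idPl/xs/on_edge0.
  + by rewrite w1l; apply/min_idPl/xs/on_edge_len.
Qed.

End EdgeGeometry.

(** * The semifield of rational functions *)

Section RatFunTheory.
Variables (R : realType) (X : metricType R).
Implicit Types (f g : X -> R) (F H : X -> \bar R) (M : model X).

Definition rational f := continuous f /\
  forall M (e : edge M), pwa (fun t => f (ept e t)) 0 (len e).

Lemma RatFunP F : RatFun X F <->
  F = cst -oo%E \/ exists2 f, F = EFin \o f & rational f.
Proof.
split=> -[->|]; [by left| |by left|].
  case=> f [-> fc fpa]; right; exists f => //; split=> // M e.
  exact: piecewise_affine_pwa (len_gt0 e) (fpa M e).
case=> f -> [fc fpa]; right; exists f; split=> // M e.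
exact: pwa_piecewise_affine.
Qed.

Lemma rational_cst c : rational (cst c).
Proof.
split=> [|M e]; first exact: cst_continuous.
by apply: pwa_ext (pwa_linear 0 c (len_gt0 e)) => t _; rewrite mul0r add0r.
Qed.

Lemma rationalD f g : rational f -> rational g -> rational (fun x => f x + g x).
Proof.
move=> [fc fp] [gc gp]; split=> [x|M e]; last exact: pwaD.
by apply: cvgD; [exact: fc|exact: gc].
Qed.

Lemma rationalN f : rational f -> rational (fun x => - f x).
Proof.
move=> [fc fp]; split=> [x|M e]; last exact: pwaN.
by apply: cvgN; exact: fc.
Qed.

Lemma rational_max f g :
  rational f -> rational g -> rational (fun x => Num.max (f x) (g x)).
Proof.
move=> [fc fp] [gc gp]; split=> [x|M e]; last exact: pwa_max.
by apply: continuous_max; [exact: fc|exact: gc].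
Qed.

Lemma rational_min f g :
  rational f -> rational g -> rational (fun x => Num.min (f x) (g x)).
Proof.
move=> /rationalN fr /rationalN gr.
rewrite (_ : (fun x => _) = fun x => - Num.max (- f x) (- g x)).
  exact/rationalN/rational_max.
by apply/funext => x; rewrite oppr_max !opprK.
Qed.

Lemma rational_mdist x : rational (mdist x).
Proof.
split=> [y|M e]; last first.
  have [w [pw wE]] := mdist_edge x e.
  by apply: pwa_ext pw => t te; rewrite wE.
apply/cvgrPdist_lt => eps eps0; near=> z.
have yz : mdist y z < eps.
  by near: z; apply/metricType_numDomainType.nbhs_mdistP; exists eps.
apply: le_lt_trans yz; rewrite ler_distl.
have := metric_triangle x y z; have := metric_triangle x z y.
by rewrite (metric_sym z y); lra.
Unshelve. all: by end_near. Qed.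

Lemma RatFun_CF1 x (l : \bar R) : (-oo < l)%E -> RatFun X (CF [set x] l).
Proof.
move=> l0; apply/RatFunP; right; case: l l0 => [r| |] // _.
  exists (fun y => - Num.min (mdist x y) r).
    by apply/funext => y; exact: CF1.
  by apply/rationalN/rational_min; [exact: rational_mdist|exact: rational_cst].
exists (fun y => - mdist x y); first by apply/funext => y; exact: CF1_pinfty.
exact/rationalN/rational_mdist.
Qed.

Lemma RatFun_subsemifield : subsemifield (RatFun X).
Proof.
have RatFun_real f : rational f -> RatFun X (EFin \o f).
  by move=> fr; apply/RatFunP; right; exists f.
split=> //.
- by apply/RatFunP; left.
- exact: RatFun_real (rational_cst 0).
- move=> F H /RatFunP[->|[f -> fr]] /RatFunP[->|[g -> gr]].
  + by apply/RatFunP; left; apply/funext => x; rewrite /trop_add /= maxxx.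
  + rewrite (_ : trop_add _ _ = EFin \o g); first exact: RatFun_real.
    by apply/funext => x; exact/max_idPr/leNye.
  + rewrite (_ : trop_add _ _ = EFin \o f); first exact: RatFun_real.
    by apply/funext => x; exact/max_idPl/leNye.
  + rewrite (_ : trop_add _ _ = EFin \o (fun x => Num.max (f x) (g x))).
      exact/RatFun_real/rational_max.
    by apply/funext => x; rewrite /trop_add /= EFin_max.
- move=> F H /RatFunP[->|[f -> fr]] /RatFunP[->|[g -> gr]].
  + by apply/RatFunP; left; apply/funext.
  + by apply/RatFunP; left; apply/funext.
  + by apply/RatFunP; left; apply/funext.
  + exact/RatFun_real/(rationalD fr gr).
- move=> F /RatFunP[->//|[f -> fr] _]; exists (EFin \o (fun x => - f x)).
    exact/RatFun_real/rationalN.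
  by apply/funext => x; rewrite /trop_mul /= -EFinD subrr.
Qed.

Lemma trop_constants_RatFun : @trop_constants R X `<=` RatFun X.
Proof.
move=> _ [[c| |] // _ <-]; apply/RatFunP; last by left.
by right; exists (cst c) => //; exact: rational_cst.
Qed.

Lemma model_generators_RatFun M : model_generators M `<=` RatFun X.
Proof. by move=> _ [[[[e _ <-]|[e _ <-]]|[e _ <-]]|[v _ <-]]; apply: RatFun_CF1;
  rewrite ?ltNyr ?ltNy0y. Qed.

End RatFunTheory.

(** * Generating all rational functions *)

Section Generation.
Variables (R : realType) (X : metricType R) (M : model X).
Variable S : set (X -> \bar R).
Hypotheses (Ssemi : subsemifield S) (Sconst : @trop_constants R X `<=` S).
Implicit Types (f g F : X -> R) (e : edge M) (v : vertex M) (x : X).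

Let L f := S (EFin \o f).

Let L_cst c : L (cst c).
Proof. by apply: Sconst; exists c%:E. Qed.

Let LD f g : L f -> L g -> L (fun x => f x + g x).
Proof. exact: subsemifieldM. Qed.

Let L_max f g : L f -> L g -> L (fun x => Num.max (f x) (g x)).
Proof.
move=> Lf Lg; rewrite /L (_ : _ \o _ = trop_add (EFin \o f) (EFin \o g)).
  exact: subsemifieldD.
by apply/funext => x; rewrite /trop_add /= EFin_max.
Qed.

Let LN f : L f -> L (fun x => - f x).
Proof.
move=> Lf; have /card_gt0P[v _] := graph_nonempty M.
have [|H SH fH] := subsemifieldV Ssemi Lf.
  by move=> /(congr1 (fun h : X -> \bar R => h (vpt v))).
rewrite /L (_ : _ \o _ = H) //; apply/funext => x.
have := congr1 (fun h : X -> \bar R => h x) fH; rewrite /trop_mul /=.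
by case: (H x) => [r| |] //= [] fr; congr EFin; lra.
Qed.

Let LMn f n : L f -> L (fun x => f x * n%:R).
Proof.
move=> Lf; elim: n => [|n IH].
  rewrite (_ : (fun x => _) = cst 0); first exact: L_cst.
  by apply/funext => x; rewrite mulr0.
rewrite (_ : (fun x => _) = fun x => f x * n%:R + f x); first exact: LD.
by apply/funext => x; rewrite -natr1; ring.
Qed.

Let LMz f (m : int) : L f -> L (fun x => f x * m%:~R).
Proof.
move=> Lf; case: m => n; first exact: LMn.
rewrite (_ : (fun x => _) = fun x => - (f x * n.+1%:R)); first exact/LN/LMn.
by apply/funext => x; rewrite NegzE mulrNz mulrN.
Qed.

(** F is the maximum of the functions of L below it that agree with it on the
    members of any finite cover by sets with this property; so it is enough to
    treat the pieces of F one at a time. *)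
Definition covers F (A : set X) := exists phi,
  [/\ L phi, forall x, phi x <= F x & forall x, A x -> phi x = F x].

Lemma coversU F A B : covers F A -> covers F B -> covers F (A `|` B).
Proof.
move=> [f [Lf fF fA]] [g [Lg gF gB]].
exists (fun x => Num.max (f x) (g x)); split; first exact: L_max.
  by move=> x; rewrite ge_max fF gF.
move=> x [Ax|Bx]; first by rewrite fA //; exact/max_idPl.
by rewrite gB //; exact/max_idPr.
Qed.

Lemma sub_covers F A B : A `<=` B -> covers F B -> covers F A.
Proof. by move=> AB [f [Lf fF fB]]; exists f; split=> // x /AB/fB. Qed.

(** Even when I is empty, A0 provides a function of L below F. *)
Lemma covers_bigcup F (I : finType) (A0 : set X) (A : I -> set X) :
  covers F A0 -> (forall i, covers F (A i)) ->
  covers F (A0 `|` \bigcup_i A i).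
Proof.
move=> A0F AF.
suff H (s : seq I) : covers F (A0 `|` [set x | exists2 i, i \in s & A i x]).
  apply: sub_covers (H (enum I)) => x [|[i _ Aix]]; first by left.
  by right; exists i => //; rewrite mem_enum.
elim: s => [|i s IH]; first by apply: sub_covers A0F => x [//|[]].
apply: sub_covers (coversU IH (AF i)) => x [|[j]]; first by left; left.
by rewrite inE => /orP[/eqP ->|js] Aj; [right|left; right; exists j].
Qed.

Lemma covers_setT F : covers F setT -> L F.
Proof.
by move=> [f [Lf _ fF]]; rewrite (_ : F = f) //; apply/funext => x; rewrite fF.
Qed.

(** The function f - n psi, for n large, lies below F: at a point x the
    difference f - F is at most 2 K dist(x, p(I)) <= 8 K psi x, because it
    vanishes on p(I). *)
Lemma covers_peak F A K (p : R -> X) (I : set R) f psi :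
  (forall x y, `|F x - F y| <= K * mdist x y) ->
  L f -> (forall x y, `|f x - f y| <= K * mdist x y) ->
  L psi -> (forall t, I t -> psi (p t) = 0) ->
  (forall x, exists2 t, I t & mdist x (p t) <= 4 * psi x) ->
  0 < K -> A `<=` p @` I ->
  (forall t, I t -> f (p t) = F (p t)) -> covers F A.
Proof.
move=> FK Lf fK Lpsi psi0 psige K0 AI fF.
have [n nK] : exists n, 8 * K <= n%:R.
  by exists (Num.truncn (8 * K)).+1; apply/ltW/truncnS_gt.
exists (fun x => f x + - (psi x * n%:R)); split.
- by apply: LD => //; apply/LN/LMn.
- move=> x; have [t It xt] := psige x.
  have h0 := fK x (p t); have h1 := FK x (p t).
  rewrite !ler_distl (fF _ It) in h0 h1.
  have d0 := mdist_ge0 x (p t).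
  have : 2 * K * mdist x (p t) <= psi x * n%:R by nra.
  by lra.
- by move=> _ /AI[t It <-]; rewrite psi0 // mul0r subr0 fF.
Qed.

(** One half of an edge of length l, the segment 0 <= t <= l / 2 of the
    parametrization p, together with the tent T over the edge and the tent H
    over its other half.  Leaving p abstract allows for both directions. *)
Section HalfEdge.
Variables (l : R) (p : R -> X) (T H : X -> R).
Hypothesis p_le : forall t t', 0 <= t <= l -> 0 <= t' <= l ->
  mdist (p t) (p t') <= `|t - t'|.
Hypothesis T_on : forall t, 0 <= t <= l -> T (p t) = Num.min t (l - t).
Hypothesis H_on : forall t, 0 <= t <= l ->
  H (p t) = Num.max (l / 4 - `|t - 3 * l / 4|) 0.
Hypothesis off : forall x, (exists t, 0 <= t <= l /\ x = p t) \/
   (T x = 0 /\ H x = 0).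
Let D x := mdist (p 0) x.

Definition tent_penalty a b x :=
  Num.max (Num.max (a - T x) (D x - T x)) (Num.max (T x - b) (H x)).

Lemma tent_penalty0 a b t : 0 <= a -> b <= l / 2 -> a <= t <= b ->
  tent_penalty a b (p t) = 0.
Proof.
move=> a0 bl /andP[at_ tb].
have te : 0 <= t <= l by lra.
have Dt : D (p t) <= t.
  have : mdist (p 0) (p t) <= `|0 - t| by apply: p_le; lra.
  by rewrite sub0r normrN ger0_norm //; lra.
have Tt : T (p t) = t by rewrite T_on //; apply/min_idPl; lra.
have Ht : H (p t) = 0.
  by rewrite H_on //; apply/max_idPr; rewrite ler0_norm; lra.
apply/eqP; rewrite eq_le /tent_penalty Tt Ht; apply/andP; split.
  by rewrite !ge_max; lra.
by rewrite !le_max lexx !orbT.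
Qed.

(** Where T <= H (off the edge, and in the last quarter of it), going through
    p 0 gives dist(x, p a) <= D + a <= (D - T) + (a - T) + 2 H.  In the third
    quarter the bound t - b = (T - b) + 2 H is used, and on the first half T is
    the coordinate. *)
Lemma tent_penalty_ge a b x : 0 <= a -> a <= b -> b <= l / 2 ->
  exists2 t, a <= t <= b & mdist x (p t) <= 4 * tent_penalty a b x.
Proof.
move=> a0 ab bl.
set q := tent_penalty a b x.
have [h1 h2 h3 h4] : [/\ a - T x <= q, D x - T x <= q, T x - b <= q & H x <= q].
  by rewrite /q /tent_penalty !le_max !lexx ?orbT.
have far : T x <= H x -> 0 <= H x ->
    exists2 t, a <= t <= b & mdist x (p t) <= 4 * q.
  move=> TH H0; exists a; first by lra.
  have := metric_triangle x (p 0) (p a); rewrite (metric_sym x (p 0)) -/(D x).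
  have : mdist (p 0) (p a) <= `|0 - a| by apply: p_le; lra.
  by rewrite sub0r normrN ger0_norm //; lra.
have [[t [te xE]]|[T0 H0]] := off x; last by apply: far; lra.
have TE := T_on te; have HE := H_on te; rewrite -xE in TE HE.
have H0 : 0 <= H x by rewrite HE le_max lexx orbT.
have dE s : 0 <= s <= l -> mdist x (p s) <= `|t - s|.
  by move=> sl; rewrite xE; exact: p_le.
have [ta|a_t] := leP t a.
  exists a; first by lra.
  have : mdist x (p a) <= `|t - a| by apply: dE; lra.
  rewrite ler0_norm ?subr_le0 //.
  by move: TE; rewrite (min_idPl _); lra.
have [tb|bt] := leP t b.
  exists t; first by lra.
  have : mdist x (p t) <= `|t - t| by apply: dE.
  by rewrite subrr normr0; lra.
have xb : mdist x (p b) <= t - b.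
  have : mdist x (p b) <= `|t - b| by apply: dE; lra.
  by rewrite gtr0_norm // subr_gt0.
have [tl|lt_] := leP t (l / 2).
  exists b; first by lra.
  by move: TE; rewrite (min_idPl _); lra.
have {}TE : T x = l - t by rewrite TE; apply/min_idPr; lra.
have [tl|lt34] := leP t (3 * l / 4).
  have {}HE : H x = t - l / 2.
    by rewrite HE ler0_norm; [rewrite (max_idPl _); lra|lra].
  by exists b; lra.
apply: far => //.
have {}HE : H x = l - t.
  by rewrite HE gtr0_norm; [rewrite (max_idPl _); lra|lra].
by lra.
Qed.

Lemma covers_half F K a b (m : int) c : 0 < K ->
  (forall x y, `|F x - F y| <= K * mdist x y) ->
  (forall x y, `|T x - T y| <= mdist x y) ->
  L T -> L H -> L D -> 0 <= a -> a <= b -> b <= l / 2 ->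
  (forall t, a <= t <= b -> F (p t) = m%:~R * t + c) ->
  covers F (p @` [set t | a <= t <= b]).
Proof.
move=> K0 FK T1 LT LH LD' a0 ab bl FE.
apply: (@covers_peak _ _ (K + `|m%:~R|) p [set t | a <= t <= b]
  (fun x => T x * m%:~R + c) (tent_penalty a b)) => //.
- move=> x y; apply: le_trans (FK x y) _.
  by rewrite ler_wpM2r ?mdist_ge0 // lerDl.
- by apply: LD; [exact: LMz|exact: L_cst].
- move=> x y; rewrite (_ : _ - _ = m%:~R * (T x - T y)); last by ring.
  rewrite normrM; have := T1 x y; have := mdist_ge0 x y.
  by have := normr_ge0 (m%:~R : R); nra.
- have La f : L f -> forall c, L (fun x => c - f x).
    by move=> /LN Lf d; exact: (LD (L_cst d) Lf).
  apply: L_max; apply: L_max => //; [exact: La|exact: (LD LD' (LN LT))|].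
  exact: (LD LT (L_cst (- b))).
- by move=> t abt; exact: tent_penalty0.
- by move=> x; exact: tent_penalty_ge.
- by rewrite ltr_wpDr.
- move=> t /= abt; rewrite FE // T_on; last by lra.
  by rewrite (min_idPl _) 1?mulrC //; lra.
Qed.

End HalfEdge.

Hypothesis Sgen : model_generators M `<=` S.

Lemma L_bump e s r : S (CF [set ept e s] r%:E) -> L (bump e s r).
Proof.
rewrite CF_bump => Sb.
rewrite (_ : bump e s r = fun x => (bump e s r x - r) + cst r x).
  by apply: LD => //; exact: L_cst.
by apply/funext => x; rewrite subrK.
Qed.

Lemma L_mdist_vpt v : L (mdist (vpt v)).
Proof.
have : S (CF [set vpt v] +oo%E) by apply: Sgen; right; exists v.
rewrite (_ : CF _ _ = EFin \o (fun x => - mdist (vpt v) x)).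
  move=> /LN; rewrite (_ : (fun x => _) = mdist (vpt v)) //.
  by apply/funext => x; rewrite opprK.
by apply/funext => x; rewrite CF1_pinfty.
Qed.

Lemma covers_edge F e K : 0 < K ->
  (forall x y, `|F x - F y| <= K * mdist x y) ->
  pwa (fun t => F (ept e t)) 0 (len e) ->
  covers F (ept e @` on_edge e).
Proof.
move=> K0 FK pF; rewrite /on_edge.
have l0 := len_gt0 e; set l := len e in l0 pF *.
have [T1 T2 T3] : [/\ 0 <= l / 2, l / 2 <= l / 2 & l / 2 + l / 2 <= l].
  by split; lra.
pose T := bump e (l / 2) (l / 2).
pose G := bump e (l / 4) (l / 4).
pose H := bump e (3 * l / 4) (l / 4).
have LT : L T by apply: L_bump; apply: Sgen; left; left; left; exists e.
have LG : L G by apply: L_bump; apply: Sgen; left; left; right; exists e.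
have LH : L H by apply: L_bump; apply: Sgen; left; right; exists e.
have T_on t : 0 <= t <= l -> T (ept e t) = Num.min t (l - t).
  move=> te; rewrite /T bump_on //.
  have [tl|tl] := leP t (l / 2).
    rewrite ler0_norm; last by lra.
    by rewrite (min_idPl _) ?(max_idPl _); lra.
  rewrite gtr0_norm; last by lra.
  by rewrite (min_idPr _) ?(max_idPl _); lra.
have offE x : (exists t, 0 <= t <= l /\ x = ept e t) \/
    [/\ T x = 0, G x = 0 & H x = 0].
  have [[t [te ->]]|xe] := pselect (edge_interior e x).
    by left; exists t; split=> //; rewrite /l; lra.
  by right; split; apply: bump_off => //; rewrite -/l; lra.
have first_half a b (m : int) c : 0 <= a -> a <= b -> b <= l / 2 ->
    (forall t, a <= t <= b -> F (ept e t) = m%:~R * t + c) ->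
    covers F (ept e @` [set t | a <= t <= b]).
  move=> a0 ab bl FE.
  apply: (@covers_half l (ept e) T H _ T_on _ _ F K _ _ m c) => //.
  - by move=> t t'; exact: mdist_edge_le.
  - by move=> t te; rewrite /H bump_on //; rewrite -/l; lra.
  - by move=> x; have [|[]] := offE x; [left|right].
  - by move=> x y; exact: bump_lipschitz.
  - by rewrite ept_src; exact: L_mdist_vpt.
have second_half a b (m : int) c : l / 2 <= a -> a <= b -> b <= l ->
    (forall t, a <= t <= b -> F (ept e t) = m%:~R * t + c) ->
    covers F (ept e @` [set t | a <= t <= b]).
  move=> al ab bl FE.
  (* Reversing e exchanges its halves and negates the slope. *)
  apply: (@sub_covers _ _
    ((fun t => ept e (l - t)) @` [set t | l - b <= t <= l - a])).
    move=> _ [t /= tab <-]; exists (l - t); last by rewrite subKr.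
    by rewrite /=; lra.
  apply: (@covers_half l (fun t => ept e (l - t)) T G _ _ _ _ F K _ _
    (- m) (m%:~R * l + c)) => //.
  - move=> t t' te te'; have -> : `|t - t'| = `|(l - t) - (l - t')|.
      by rewrite distrC; congr `|_|; ring.
    by apply: mdist_edge_le; rewrite /on_edge /= -/l; lra.
  - by move=> t te; rewrite T_on ?subKr 1?minC //; lra.
  - move=> t te; rewrite /G bump_on //; rewrite -?/l; try lra.
      by rewrite distrC; congr (Num.max (_ - `|_|) _); lra.
    by rewrite /on_edge /= -/l; lra.
  - move=> x; have [[t [te ->]]|[]] := offE x; [left|by right].
    by exists (l - t); rewrite subKr; split=> //; lra.
  - by move=> x y; exact: bump_lipschitz.
  - by rewrite subr0 ept_tgt; exact: L_mdist_vpt.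
  - by lra.
  - by lra.
  - by lra.
  - move=> t abt; rewrite FE; last by lra.
    by rewrite intrN; ring.
suff seg a b : pwa (fun t => F (ept e t)) a b -> 0 <= a -> b <= l ->
    covers F (ept e @` [set t | a <= t <= b]) by exact: (seg 0 l).
elim=> {a b} [a b m c ab FE|a b c pab IH1 pbc IH2] a0 bl.
  have [b2|b2] := leP b (l / 2).
    by apply: first_half FE => //; exact: ltW.
  have [a2|a2] := leP (l / 2) a.
    by apply: second_half FE => //; exact: ltW.
  apply: (@sub_covers _ _ (ept e @` [set t | a <= t <= l / 2] `|`
                           ept e @` [set t | l / 2 <= t <= b])).
    move=> _ [t /= tab <-]; have [tl|tl] := leP t (l / 2).
      by left; exists t => //=; lra.
    by right; exists t => //=; lra.
  apply: coversU.
    by apply: (@first_half _ _ m c) => // [|t tab]; [lra|apply: FE; lra].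
  by apply: (@second_half _ _ m c) => // [|t tab]; [lra|apply: FE; lra].
have [ab bc] := (pwa_lt pab, pwa_lt pbc).
apply: (@sub_covers _ _ (ept e @` [set t | a <= t <= b] `|`
                         ept e @` [set t | b <= t <= c])).
  move=> _ [t /= tab <-]; have [tb|tb] := leP t b.
    by left; exists t => //=; lra.
  by right; exists t => //=; lra.
by apply: coversU; [apply: IH1|apply: IH2]; lra.
Qed.

Lemma covers_vertex F v K : 0 < K ->
  (forall x y, `|F x - F y| <= K * mdist x y) -> covers F [set vpt v].
Proof.
move=> K0 FK; pose p (_ : R) := vpt v.
apply: (@covers_peak _ _ K p setT (cst (F (vpt v))) (mdist (vpt v))) => //.
- by move=> x y; rewrite subrr normr0 mulr_ge0 ?mdist_ge0 // ltW.
- exact: L_mdist_vpt.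
- by move=> t _; exact: mdistxx.
- move=> x; exists 0; rewrite // metric_sym.
  by have := mdist_ge0 (vpt v) x; lra.
- by move=> _ ->; exists 0.
Qed.

Lemma rational_edge_lipschitz F : rational F ->
  exists2 K, 0 < K & edge_lipschitz M K F.
Proof.
move=> [_ /(_ M) FM].
have /choice[k kP] e : exists K, 0 < K /\ forall t t', on_edge e t ->
    on_edge e t' -> `|F (ept e t) - F (ept e t')| <= K * `|t - t'|.
  by have [K K0 HK] := pwa_lipschitz (FM e); exists K; split.
have k_ge0 e : 0 <= k e by apply/ltW; have [] := kP e.
exists (1 + \sum_e k e); first by rewrite ltr_pwDl // sumr_ge0.
move=> e t t' te te'; have [_ /(_ t t' te te')] := kP e.
move=> /le_trans; apply; apply: ler_wpM2r => //.
by rewrite (bigD1 e) //= addrCA lerDl addr_ge0 // sumr_ge0.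
Qed.

Lemma RatFun_sub : RatFun X `<=` S.
Proof.
move=> _ /RatFunP[->|[F -> Fr]]; first exact: subsemifield0.
have [K K0 /(edge_lipschitz_mdist K0) FK] := rational_edge_lipschitz Fr.
have /card_gt0P[v0 _] := graph_nonempty M.
apply: covers_setT.
have cV := covers_bigcup (covers_vertex v0 K0 FK)
  (fun v => covers_vertex v K0 FK).
have := covers_bigcup cV (fun e => covers_edge K0 FK (Fr.2 M e)).
apply: sub_covers => x _; have [[v ->]|[e [t [te ->]]]] := model_surj M x.
  by left; right; exists v.
by right; exists e => //; exists t => //; rewrite /on_edge /=; lra.
Qed.

End Generation.

Theorem RatFun_generated (R : realType) (X : metricType R) (M : model X) :
  RatFun X = generated_semifield (model_generators M).
Proof.
apply/seteqP; split=> [F FX S [Ss]|].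
  by rewrite subUset => -[Sc Sg]; exact: (RatFun_sub Ss Sc Sg FX).
apply: smallest_sub; first exact: RatFun_subsemifield.
by rewrite subUset; split;
  [exact: trop_constants_RatFun|exact: model_generators_RatFun].
Qed.

Theorem proposition3p6 (R : realType) (X : metricType R)
    (hX : metric_graph X) :
  (forall M : model X, canonical_model M ->
     RatFun X = generated_semifield (model_generators M)) /\
  finitely_generated_semifield (RatFun X).
Proof.
split=> [M _|]; first exact: RatFun_generated.
have [M] := hX; exists (model_generators M); split.
- by rewrite /model_generators !finite_setU; do ![split]; exact: finite_image.
- exact: model_generators_RatFun.
- exact: RatFun_generated.
Qed.
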